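(* Let $F$ be the free semilattice of infinite rank with free generators $\{a_i\mid i\in I\}$, and let $S$ be a finitely generated $F$-semilattice such that $\mathrm{Hom}_F(S,F)\neq\emptyset$. The following conditions are equivalent: 1. $S$ is a coordinate semilattice over $F$ of a nonempty irreducible algebraic set; 2. $S$ is $F$-embeddable into the free product $F\ast F(T)$, where $F(T)$ is a free semilattice generated by a finite set $T=\{t_1,\dots,t_n\}$; 3. for every $i\in I$, the following two sentences hold in $S$: $$\varphi_i:\ \forall x,y\ \bigl(xa_i=ya_i \leftrightarrow (xa_i=y\ \vee\ x=ya_i\ \vee\ x=y)\bigr),$$ $$\psi_i:\ \forall x,y\ \bigl(xy\le a_i\to (x\le a_i\ \vee\ y\le a_i)\bigr).$$
   Context: A semilattice is a commutative idempotent semigroup; in any semilattice $b\le c$ means $bc=b$. $F$ is the free semilattice on the generators $\{a_i\mid i\in I\}$: its elements are the finite nonempty products of distinct generators. Its rank is $|I|$, assumed infinite. An $F$-semilattice is a semilattice $S$ with a fixed embedding $\varepsilon_S:F\to S$ (elements of $F$ are identified with their images). It is finitely generated if it is generated by finitely many elements together with $F$. An $F$-homomorphism $\psi:S\to L$ between $F$-semilattices is a semilattice homomorphism with $\psi\circ\varepsilon_S=\varepsilon_L$; $\mathrm{Hom}_F(S,L)$ is the set of these. An $F$-embedding is an injective $F$-homomorphism. Free products are taken in the class of semilattices, and $F\ast F(T)$ is an $F$-semilattice via the canonical inclusion of $F$. For a finite set of variables $X=\{x_1,\dots,x_n\}$, an $F$-term is an element of $F\ast F(X)$, where $F(X)$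 is the free semilattice on $X$; i.e. $w(X)a$, $w(X)$ or $a$ with $w(X)\in F(X)$, $a\in F$. An $F$-equation is a formal equality of two $F$-terms; a system is any set of $F$-equations in finitely many variables. A set $Y\subseteq F^n$ is algebraic if it is the solution set in $F^n$ of some system of $F$-equations. An algebraic set is irreducible if it is not a finite union of algebraic sets properly contained in it. The coordinate semilattice $\Gamma(Y)$ of an algebraic set $Y\subseteq F^n$ is the set of $F$-terms in $x_1,\dots,x_n$ modulo the relation identifying two terms that take the same value at every point of $Y$, with the induced multiplication; for $Y\ne\emptyset$ it is an $F$-semilattice. An $F$-semilattice is called a coordinate semilattice of $Y$ if it is $F$-isomorphic to $\Gamma(Y)$. *)

(* Defs.v *)
From HB Require Import structures.
From mathcomp Require Import all_boot all_order finmap.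
From mathcomp Require Import boolp classical_sets functions cardinality.
From mathcomp Require Import generic_quotient.

Set Implicit Arguments.
Unset Strict Implicit.
Unset Printing Implicit Defensive.

Import Order.LTheory.

(* A semilattice is a [meetSemilatticeType]: the product is the meet, written
   x `&` y in [order_scope], so that x <= y iff x `&` y = x (lemma
   [Order.LTheory.leEmeet]). The factory below presents it as a commutative
   idempotent semigroup. *)
HB.factory Record isSemilattice (d : Order.disp_t) T of Choice T := {
  op : T -> T -> T;
  opC : commutative op;
  opA : associative op;
  opxx : idempotent_op op;
}.

HB.builders Context (d : Order.disp_t) T of isSemilattice d T.

Definition le : rel T := fun x y => op x y == x.

Fact le_refl : reflexive le.
Proof. by move=> x; rewrite /le opxx. Qed.

Fact le_anti : antisymmetric le.
Proof. by move=> x y /andP[/eqP xy /eqP yx]; rewrite -xy opC yx. Qed.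

Fact le_trans : transitive le.
Proof. by move=> y x z /eqP xy /eqP yz; rewrite /le -xy -opA yz. Qed.

HB.instance Definition _ :=
  @Order.Le_isPOrder.Build d T le le_refl le_anti le_trans.
HB.instance Definition _ :=
  @Order.POrder_Meet_isSemilattice.Build d T op opC opA (fun _ _ => erefl).

HB.end.

Fact semilattice_display : Order.disp_t.
Proof. exact: (Order.Disp tt tt). Qed.

Definition is_hom d d' (A : meetSemilatticeType d) (B : meetSemilatticeType d')
    (f : A -> B) : Prop :=
  forall x y, f (x `&` y)%O = (f x `&` f y)%O.

(* A product of distinct generators is the nonempty finite set of these
   generators; multiplication is union. *)
Record freesl (K : choiceType) : Type := FreeSL {
  freesl_val : {fset K};
  freesl_valP : freesl_val != fset0%fset }.

Section FreeSemilattice.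
Local Open Scope fset_scope.
Variable K : choiceType.
Implicit Types A B C : freesl K.

HB.instance Definition _ := [isSub for @freesl_val K].
HB.instance Definition _ := [Choice of freesl K by <:].

Fact freesl_op_subproof A B : val A `|` val B != fset0.
Proof. by rewrite fsetU_eq0 negb_and (valP A). Qed.

Definition freesl_op A B : freesl K := FreeSL (freesl_op_subproof A B).

Fact freesl_opC : commutative freesl_op.
Proof. by move=> A B; apply: val_inj; rewrite /= fsetUC. Qed.

Fact freesl_opA : associative freesl_op.
Proof. by move=> A B C; apply: val_inj; rewrite /= fsetUA. Qed.

Fact freesl_opxx : idempotent_op freesl_op.
Proof. by move=> A; apply: val_inj; rewrite /= fsetUid. Qed.

HB.instance Definition _ := isSemilattice.Build semilattice_display (freesl K)
  freesl_opC freesl_opA freesl_opxx.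

Lemma val_freeslI A B : val (A `&` B)%O = val A `|` val B.
Proof. by []. Qed.

Fact freegen_subproof (k : K) : [fset k] != fset0.
Proof. by apply/fset0Pn; exists k; rewrite inE. Qed.

Definition freegen (k : K) : freesl K := FreeSL (freegen_subproof k).

Definition freesl_pick A : K := xchoose (fset0Pn _ (valP A)).

Lemma freesl_pickP A : freesl_pick A \in val A.
Proof. exact: xchooseP. Qed.

(* The product of the [f k] over the generators k of A; the factor used as the
   initial value also occurs in the product, so it is harmless. *)
Definition free_lift d (L : meetSemilatticeType d) (f : K -> L) A : L :=
  \big[Order.meet/f (freesl_pick A)]_(k <- val A) f k.

Section Universal.
Context {d : Order.disp_t} {L : meetSemilatticeType d}.
Implicit Types f : K -> L.

Lemma le_free_lift f A (y : L) :
  reflect (forall k, k \in val A -> (y <= f k)%O) (y <= free_lift f A)%O.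
Proof.
rewrite /free_lift.
suff -> x (s : seq K) : (y <= \big[Order.meet/x]_(k <- s) f k)%O =
    (y <= x)%O && all (fun k => y <= f k)%O s.
  apply: (iffP andP) => [[_ /allP//]|yf]; split; last exact/allP.
  exact/yf/freesl_pickP.
elim: s => [|k s IHs]; first by rewrite big_nil andbT.
by rewrite big_cons lexI IHs andbCA.
Qed.

Lemma free_lift_hom f : is_hom (free_lift f).
Proof.
move=> A B; apply: le_anti; rewrite lexI -andbA; apply/and3P; split.
- apply/le_free_lift => k kA.
  have /le_free_lift := lexx (free_lift f (A `&` B)%O); apply.
  by rewrite val_freeslI inE kA.
- apply/le_free_lift => k kB.
  have /le_free_lift := lexx (free_lift f (A `&` B)%O); apply.
  by rewrite val_freeslI inE kB orbT.
- apply/le_free_lift => k; rewrite val_freeslI inE => /orP[kA|kB].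
  + by rewrite leIxl//; have /le_free_lift := lexx (free_lift f A); apply.
  + by rewrite leIxr//; have /le_free_lift := lexx (free_lift f B); apply.
Qed.

Lemma free_lift_gen f k : free_lift f (freegen k) = f k.
Proof.
apply: le_anti; apply/andP; split.
  have /le_free_lift := lexx (free_lift f (freegen k)).
  by apply; rewrite inE.
by apply/le_free_lift => j; rewrite inE => /eqP->.
Qed.

Lemma free_lift_unique f (g : freesl K -> L) :
  is_hom g -> (forall k, g (freegen k) = f k) -> g =1 free_lift f.
Proof.
move=> gM gf A; have [s] := ubnP #|` val A|; elim: s A => // s IHs A.
rewrite ltnS => As; have [->|nA] := eqVneq A (freegen (freesl_pick A)).
  by rewrite free_lift_gen gf.
have pA := freesl_pickP A; pose B := val A `\ freesl_pick A.
have B0 : B != fset0.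
  apply: contra nA => /eqP B0; apply/eqP/val_inj => /=.
  by rewrite -(fsetD1K pA) -/B B0 fsetU0.
have -> : A = (freegen (freesl_pick A) `&` FreeSL B0)%O.
  by apply: val_inj; rewrite val_freeslI /= fsetD1K.
rewrite gM free_lift_hom gf free_lift_gen IHs//=.
by move: As; rewrite (cardfsD1 (freesl_pick A)) pA.
Qed.

End Universal.
End FreeSemilattice.

(* Coproduct of semilattices: every element is uniquely a, b or ab, with a and b
   in the factors ([fp_lift_hom] and [fp_lift_unique] give universality). *)
Inductive free_product (A B : Type) : Type :=
  | FPl of A
  | FPr of B
  | FPlr of A & B.
Arguments FPl {A B} a.
Arguments FPr {A B} b.
Arguments FPlr {A B} a b.

Section FreeProduct.

Definition fp_code A B (u : free_product A B) : A + B + A * B :=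
  match u with
  | FPl a => inl (inl a) | FPr b => inl (inr b) | FPlr a b => inr (a, b)
  end.

Definition fp_decode A B (u : A + B + A * B) : free_product A B :=
  match u with
  | inl (inl a) => FPl a | inl (inr b) => FPr b | inr (a, b) => FPlr a b
  end.

Lemma fp_codeK A B : cancel (@fp_code A B) (@fp_decode A B).
Proof. by case. Qed.

HB.instance Definition _ (A B : choiceType) :=
  Choice.copy (free_product A B) (can_type (@fp_codeK A B)).

Context {dA dB : Order.disp_t}.
Context {A : meetSemilatticeType dA} {B : meetSemilatticeType dB}.
Local Open Scope order_scope.

Definition fp_op (u v : free_product A B) : free_product A B :=
  match u, v with
  | FPl a, FPl a' => FPl (a `&` a')
  | FPl a, FPr b' => FPlr a b'
  | FPl a, FPlr a' b' => FPlr (a `&` a') b'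
  | FPr b, FPl a' => FPlr a' b
  | FPr b, FPr b' => FPr (b `&` b')
  | FPr b, FPlr a' b' => FPlr a' (b `&` b')
  | FPlr a b, FPl a' => FPlr (a `&` a') b
  | FPlr a b, FPr b' => FPlr a (b `&` b')
  | FPlr a b, FPlr a' b' => FPlr (a `&` a') (b `&` b')
  end.

Fact fp_opC : commutative fp_op.
Proof.
by case=> [a|b|a b] [a'|b'|a' b'] //=;
  rewrite ?[a' `&` _]meetC ?[b' `&` _]meetC.
Qed.

Fact fp_opA : associative fp_op.
Proof.
by case=> [a|b|a b] [a'|b'|a' b'] [a''|b''|a'' b''] //=; rewrite ?meetA.
Qed.

Fact fp_opxx : idempotent_op fp_op.
Proof. by case=> [a|b|a b] /=; rewrite ?meetxx. Qed.

HB.instance Definition _ := isSemilattice.Build semilattice_display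
  (free_product A B) fp_opC fp_opA fp_opxx.

Lemma FPl_hom : is_hom (FPl : A -> free_product A B). Proof. by []. Qed.

Lemma FPr_hom : is_hom (FPr : B -> free_product A B). Proof. by []. Qed.

Lemma FPl_inj : injective (FPl : A -> free_product A B).
Proof. by move=> a a' []. Qed.

Section Universal.
Context {d : Order.disp_t} {L : meetSemilatticeType d}.
Implicit Types (f : A -> L) (g : B -> L).

Definition fp_lift f g (u : free_product A B) : L :=
  match u with
  | FPl a => f a | FPr b => g b | FPlr a b => f a `&` g b
  end.

Lemma fp_lift_hom f g : is_hom f -> is_hom g -> is_hom (fp_lift f g).
Proof.
move=> fM gM [a|b|a b] [a'|b'|a' b'] //=; rewrite ?fM ?gM ?meetA //.
- by rewrite meetC.
- by rewrite [g b `&` f a']meetC.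
- by rewrite meetAC.
- by rewrite [f a `&` g b `&` f a']meetAC.
Qed.

Lemma fp_lift_unique f g (h : free_product A B -> L) : is_hom h ->
  (forall a, h (FPl a) = f a) -> (forall b, h (FPr b) = g b) ->
  h =1 fp_lift f g.
Proof.
by move=> hM hf hg [a|b|a b] //=; rewrite -hf -hg -hM.
Qed.

End Universal.
End FreeProduct.

(* F is the free semilattice [freesl I]; [Femb] is the embedding of F. *)

Record Fsemilattice (I : choiceType) (d : Order.disp_t) := MkFsemilattice {
  Fcarrier :> meetSemilatticeType d;
  Femb : freesl I -> Fcarrier;
  Femb_hom : is_hom Femb;
  Femb_inj : injective Femb }.
Arguments Femb {I d} S _ : rename.

Definition self_Fsemilattice (I : choiceType) :
    Fsemilattice I semilattice_display :=
  @MkFsemilattice I _ (freesl I) id (fun _ _ => erefl) (fun _ _ => id).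

Definition fp_Fsemilattice (I : choiceType) (d : Order.disp_t)
    (B : meetSemilatticeType d) : Fsemilattice I semilattice_display :=
  @MkFsemilattice I _ (free_product (freesl I) B) FPl FPl_hom FPl_inj.

Section FSemilattices.
Local Open Scope classical_set_scope.

Definition Hom_F I d d' (S : Fsemilattice I d) (L : Fsemilattice I d') :
    set (S -> L) :=
  [set psi : S -> L | is_hom psi /\ psi \o Femb S =1 Femb L].
Global Arguments Hom_F {I d d'} S L.

Definition F_embeddable I d d' (S : Fsemilattice I d) (L : Fsemilattice I d') :
    Prop :=
  exists2 psi : S -> L, Hom_F S L psi & injective psi.

Definition F_isomorphic I d d' (S : Fsemilattice I d) (L : Fsemilattice I d') :
    Prop :=
  exists2 psi : S -> L, Hom_F S L psi & bijective psi.

Definition op_closed d (L : meetSemilatticeType d) (B : set L) : Prop :=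
  forall x y, B x -> B y -> B (x `&` y)%O.

Definition finitely_generated I d (S : Fsemilattice I d) : Prop :=
  exists2 A : set S, finite_set A &
    smallest (@op_closed d S) (range (Femb S) `|` A) = setT.

End FSemilattices.

Section AlgebraicSets.
Variables (I : choiceType) (n : nat).
Local Open Scope classical_set_scope.
Local Open Scope quotient_scope.

Definition Fpoint : Type := {ffun 'I_n -> freesl I}.

Definition Fterm : Type := free_product (freesl I) (freesl 'I_n).
HB.instance Definition _ := Order.MeetSemilattice.on Fterm.

Definition Feval (p : Fpoint) : Fterm -> freesl I := fp_lift id (free_lift p).

Lemma Feval_hom p : is_hom (Feval p).
Proof. by apply: fp_lift_hom => //; exact: free_lift_hom. Qed.

Definition solutions (E : set (Fterm * Fterm)) : set Fpoint :=
  [set p | forall e, E e -> Feval p e.1 = Feval p e.2].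

Definition algebraic (Y : set Fpoint) : Prop := exists E, Y = solutions E.

(* m = 0 is allowed, so the empty set is not irreducible. *)
Definition irreducible (Y : set Fpoint) : Prop :=
  ~ exists (m : nat) (Z : 'I_m -> set Fpoint),
      (forall j, algebraic (Z j) /\ Z j `<` Y) /\ Y = \bigcup_j Z j.

Section CoordinateSemilattice.
Variable Y : set Fpoint.

Definition coord_rel : rel Fterm :=
  fun s t => `[< forall p, Y p -> Feval p s = Feval p t >].

Fact coord_rel_refl : reflexive coord_rel.
Proof. by move=> s; apply/asboolP. Qed.

Fact coord_rel_sym : symmetric coord_rel.
Proof. by move=> s t; apply/asboolP/asboolP => st p Yp; rewrite st. Qed.

Fact coord_rel_trans : transitive coord_rel.
Proof.
by move=> t s u /asboolP st /asboolP tu; apply/asboolP => p Yp; rewrite st// tu.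
Qed.

Canonical coord_equiv :=
  EquivRel coord_rel coord_rel_refl coord_rel_sym coord_rel_trans.

Definition coord : Type := {eq_quot coord_equiv}.
HB.instance Definition _ := Choice.on coord.
HB.instance Definition _ := EqQuotient.on coord.

Lemma eq_coordP (s t : Fterm) :
  \pi_coord s = \pi_coord t <-> forall p, Y p -> Feval p s = Feval p t.
Proof. by split=> [/eqmodP/asboolP|st]//; apply/eqmodP/asboolP. Qed.

Definition coord_op (u v : coord) : coord :=
  \pi_coord (repr u `&` repr v : Fterm)%O.

Lemma coord_op_pi (s t : Fterm) :
  coord_op (\pi_coord s) (\pi_coord t) = \pi_coord (s `&` t : Fterm)%O.
Proof.
apply/eq_coordP => p Yp; rewrite !Feval_hom.
by congr (_ `&` _)%O; move: p Yp; apply/eq_coordP; rewrite reprK.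
Qed.

Fact coord_opC : commutative coord_op.
Proof. by move=> u v; rewrite /coord_op meetC. Qed.

Fact coord_opA : associative coord_op.
Proof.
move=> u v w; have := meetA (repr u : Fterm) (repr v) (repr w).
by move=> /(congr1 \pi_coord); rewrite -!coord_op_pi !reprK.
Qed.

Fact coord_opxx : idempotent_op coord_op.
Proof. by move=> u; rewrite /coord_op meetxx reprK. Qed.

HB.instance Definition _ := isSemilattice.Build semilattice_display coord
  coord_opC coord_opA coord_opxx.

Definition coord_cst (a : freesl I) : coord := \pi_coord (FPl a : Fterm).

Fact coord_cst_hom : is_hom coord_cst.
Proof. by move=> a b; rewrite /coord_cst [RHS]coord_op_pi. Qed.

Fact coord_cst_inj : Y !=set0 -> injective coord_cst.
Proof. by move=> [p Yp] a b /eq_coordP/(_ p Yp). Qed.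

Definition Gamma (Y0 : Y !=set0) : Fsemilattice I semilattice_display :=
  @MkFsemilattice I _ coord coord_cst coord_cst_hom (coord_cst_inj Y0).

End CoordinateSemilattice.
End AlgebraicSets.

(* Main.v *)
Require Import Defs.
From mathcomp Require Import all_boot all_order finmap.
From mathcomp Require Import boolp classical_sets functions cardinality.

(** Call an F-semilattice S discriminated when any finitely many of its
elements are kept distinct by a single F-homomorphism S -> F.  Each of the
three conditions amounts to S being discriminated.

A coordinate semilattice is separated by its evaluations at the points of Y;
if no point separated a given finite family, Y would be the union of the
finitely many proper algebraic subsets on which two members of the family
agree, so irreducibility is exactly what makes one point separate them all
([Gamma_discriminated]).  Conversely, for S generated over F by s_1, ..., s_m,
the points (h s_1, ..., h s_m), with h an F-homomorphism, form the algebraic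
set Y of solutions of all the relations of S; discrimination gives at once that
S is its coordinate semilattice and that Y is irreducible
([discriminated_coordinate]).

Sending the letters t_k to fresh distinct generators of F, which exist because
the rank is infinite, discriminates F * F(T) ([free_product_discriminated]),
hence everything that embeds into it.

The sentences phi_i and psi_i are universal with constants in F and hold in F,
so they hold in a discriminated S ([discriminated_phi_psi]).  For the way back
([phi_psi_embeddable]) attach to x in S two coordinates: the finite set
I(x) = {i | x <= a_i}, and the class of x modulo the congruence
xf = yf for some f in F.  The first coordinate is a homomorphism by psi_i.  The
quotient is a finite semilattice in which F collapses to a unit, hence it
embeds into the subsets of a finite set, under union.  By phi_i the two
coordinates together determine x ([cancel_F]), so that x goes to a subset of
I + T, and it only remains to exclude the empty one ([content_neq0]). *)

Set Implicit Arguments.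
Unset Strict Implicit.
Unset Printing Implicit Defensive.

Import Order.LTheory.

Local Open Scope order_scope.

(** * Free semilattices and F-homomorphisms *)

Section FreeSemilattice.
Variable K : choiceType.
Implicit Types A B : freesl K.

Lemma freesl_ind (P : freesl K -> Prop) : (forall k, P (freegen k)) ->
  (forall A B, P A -> P B -> P (A `&` B)) -> forall A, P A.
Proof.
move=> Pgen PI A; have [m] := ubnP #|` val A|; elim: m A => // m IHm A.
rewrite ltnS => Am; have [->|nA] := eqVneq A (freegen (freesl_pick A)).
  exact: Pgen.
have pA := freesl_pickP A; pose B := (val A `\ freesl_pick A)%fset.
have B0 : B != fset0.
  apply: contra nA => /eqP B0; apply/eqP/val_inj => /=.
  by rewrite -(fsetD1K pA) -/B B0 fsetU0.
have -> : A = freegen (freesl_pick A) `&` FreeSL B0.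
  by apply: val_inj; rewrite val_freeslI /= fsetD1K.
apply: PI; first exact: Pgen.
by apply: IHm => /=; move: Am; rewrite (cardfsD1 (freesl_pick A)) pA.
Qed.

Lemma le_freegen A k : (A <= freegen k) = (k \in val A).
Proof.
rewrite leEmeet -val_eqE val_freeslI /=; apply/eqP/idP => [<-|kA].
  by rewrite !inE eqxx orbT.
by apply/fsetP => j; rewrite !inE orbC; case: eqP => // ->.
Qed.

Lemma val_free_lift_freegen (J : choiceType) (j : K -> J) A :
  val (free_lift (fun k => freegen (j k)) A) = (j @` val A)%fset.
Proof.
elim/freesl_ind: A => [k|A B IHA IHB].
  by rewrite free_lift_gen /= imfset_fset1.
by rewrite free_lift_hom !val_freeslI IHA IHB imfsetU.
Qed.

End FreeSemilattice.

Lemma freesl_finite (T : finType) :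
  exists r : seq (freesl T), forall A, A \in r.
Proof.
exists (pmap insub (enum_fset (fpowerset [fset x | x : T]%fset))) => A.
rewrite mem_pmap_sub -[_ \in _]/(val A \in fpowerset _) fpowersetE.
by apply/fsubsetP => k _; rewrite !inE.
Qed.

Lemma hom_le d d' (A : meetSemilatticeType d) (B : meetSemilatticeType d')
    (h : A -> B) : is_hom h -> {homo h : x y / x <= y}.
Proof. by move=> hM x y /meet_idPl xy; apply/meet_idPl; rewrite -hM xy. Qed.

Lemma Hom_F_comp (I : choiceType) d1 d2 d3 (S : Fsemilattice I d1)
    (L : Fsemilattice I d2) (M : Fsemilattice I d3) f g :
  Hom_F S L f -> Hom_F L M g -> Hom_F S M (g \o f).
Proof.
move=> [fM fF] [gM gF]; split=> [x y|a] /=; first by rewrite fM gM.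
by have /= -> := fF a; exact: gF.
Qed.

Section FSemilattice.
Variables (I : choiceType) (d : Order.disp_t) (S : Fsemilattice I d).
Local Notation F := (self_Fsemilattice I).
Local Notation a i := (Femb S (freegen i)).

Lemma Femb_le (f g : freesl I) : (Femb S f <= Femb S g) = (f <= g).
Proof. by rewrite !leEmeet -Femb_hom (inj_eq (@Femb_inj _ _ S)). Qed.

(** The existence of an F-homomorphism to F forces every element of S to lie
below finitely many generators only: they all divide its image. *)
Lemma Hom_F_le_gen (h : S -> freesl I) x i :
  Hom_F S F h -> x <= a i -> i \in val (h x).
Proof.
by move=> [hM hF] /(hom_le hM); have /= -> := hF (freegen i); rewrite le_freegen.
Qed.

(** * Evaluation of F-terms in an F-semilattice *)

Definition term_eval m (s : 'I_m -> S) : Fterm I m -> S :=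
  fp_lift (Femb S) (free_lift s).

Lemma term_eval_hom m (s : 'I_m -> S) : is_hom (term_eval s).
Proof. exact: fp_lift_hom (@Femb_hom _ _ S) (free_lift_hom s). Qed.

Lemma Feval_term_eval m (s : 'I_m -> S) (h : S -> freesl I) (t : Fterm I m) :
  Hom_F S F h -> Feval [ffun k => h (s k)] t = h (term_eval s t).
Proof.
move=> [hM hF]; symmetry; move: t.
apply: (@fp_lift_unique _ _ _ _ _ _ id _ (h \o term_eval s)) => [t u|f|A] /=.
- by rewrite term_eval_hom hM.
- exact: hF.
- apply: (free_lift_unique (g := h \o free_lift s)) => [B C|k] /=.
    by rewrite free_lift_hom hM.
  by rewrite free_lift_gen ffunE.
Qed.

Lemma finitely_generated_term_eval : finitely_generated S ->
  exists m (s : 'I_m -> S), forall x, exists t, term_eval s t = x.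
Proof.
move=> [A /finite_fsetP[B ->]] genB.
pose s k := tnth (in_tuple (enum_fset B)) k; exists _, s => x.
suff sub : (smallest (@op_closed d S) (range (Femb S) `|` [set` B]) `<=`
    range (term_eval s))%classic.
  by have [|t _ <-] := sub x; [rewrite genB|exists t].
apply: smallest_sub => [y z|y []].
- move=> [t _ <-] [u _ <-]; exists (t `&` u) => //; exact: term_eval_hom.
- by move=> [f _ <-]; exists (FPl f).
- move=> yB; have yB' : (index y (enum_fset B) < #|` B|)%N by rewrite index_mem.
  exists (FPr (freegen (Ordinal yB'))) => //=.
  by rewrite free_lift_gen /s (tnth_nth y) nth_index.
Qed.

(** * Discriminated F-semilattices *)

Definition discriminated : Prop := forall s : seq S,
  exists2 h, Hom_F S F h & {in s &, injective h}.

Definition phi_psi : Prop := forall i : I,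
  (forall x y : S, x `&` a i = y `&` a i <->
     [\/ x `&` a i = y, x = y `&` a i | x = y]) /\
  (forall x y : S, x `&` y <= a i -> x <= a i \/ y <= a i).

(** phi_i and psi_i only involve the four elements x, y, xa_i and ya_i; an
F-homomorphism to F injective on these turns both sentences into statements
about finite sets. *)
Lemma discriminated_phi_psi : discriminated -> phi_psi.
Proof.
move=> discS i; split=> x y;
  have [h [hM hF] hinj] := discS [:: x; y; x `&` a i; y `&` a i];
  have ha : h (a i) = freegen i by [have /= -> := hF (freegen i)]; last first.
  move=> /(Hom_F_le_gen (conj hM hF)); rewrite hM val_freeslI inE -!le_freegen.
  by move=> /orP[] /meet_idPl xi; [left|right]; apply/meet_idPl; apply: hinj;
    rewrite ?hM ?ha // !inE eqxx ?orbT.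
split; last by move=> [<-|->|->//]; rewrite -meetA meetxx.
move=> /(congr1 (fun z => val (h z))); rewrite !hM ha !val_freeslI /= => xy.
have [ix|nix] := boolP (i \in val (h x));
  have [iy|niy] := boolP (i \in val (h y)).
- apply: Or33; apply: hinj; rewrite ?inE ?eqxx ?orbT //; apply: val_inj.
  have /fsetUidPl <- : ([fset i] `<=` val (h x))%fset by rewrite fsub1set.
  by rewrite xy; apply/fsetUidPl; rewrite fsub1set.
- apply: Or32; apply: hinj; rewrite ?inE ?eqxx ?orbT // hM ha; apply: val_inj.
  rewrite val_freeslI /= -xy; symmetry; apply/fsetUidPl; by rewrite fsub1set.
- apply: Or31; apply: hinj; rewrite ?inE ?eqxx ?orbT // hM ha; apply: val_inj.
  rewrite val_freeslI /= xy; apply/fsetUidPl; by rewrite fsub1set.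
- apply: Or33; apply: hinj; rewrite ?inE ?eqxx ?orbT //; apply: val_inj.
  apply/fsetP => j; have /fsetP/(_ j) := xy; rewrite !inE.
  by case: eqP => [->|]; rewrite ?(negbTE nix) ?(negbTE niy) ?orbF.
Qed.

End FSemilattice.

Lemma embeddable_discriminated (I : choiceType) d d' (S : Fsemilattice I d)
    (L : Fsemilattice I d') :
  F_embeddable S L -> discriminated L -> discriminated S.
Proof.
move=> [psi psiH psi_inj] discL s; have [h hH hinj] := discL (map psi s).
exists (h \o psi); first exact: Hom_F_comp psiH hH.
by move=> x y xs ys /hinj xy; apply/psi_inj/xy; exact: map_f.
Qed.

(** * Coordinate semilattices of irreducible algebraic sets *)

Section Coordinate.
Variables (I : choiceType) (n : nat) (Y : set (Fpoint I n)).
Hypothesis Y0 : (Y !=set0)%classic.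

Definition point_eval (p : Fpoint I n) (u : Gamma Y0) : freesl I :=
  Feval p (repr (u : coord Y)).

Lemma point_eval_pi p t : Y p -> point_eval p (\pi_(coord Y) t)%qT = Feval p t.
Proof. by move=> Yp; move: p Yp; apply/eq_coordP; rewrite reprK. Qed.

Lemma Hom_F_point_eval p :
  Y p -> Hom_F (Gamma Y0) (self_Fsemilattice I) (point_eval p).
Proof.
move=> Yp; split=> [u v|f]; last by rewrite /= point_eval_pi.
by rewrite [u `&` v]/(coord_op _ _) point_eval_pi // Feval_hom.
Qed.

(** If every point of Y identified two distinct members of s, then Y would be
the union, over the finitely many pairs of distinct members of s, of the
algebraic sets where the two members agree; each is proper since distinct
elements of the coordinate semilattice differ at some point of Y. *)
Lemma Gamma_discriminated :
  algebraic Y -> irreducible Y -> discriminated (Gamma Y0).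
Proof.
move=> [E YE] irrY s.
suff [p Yp pinj] : exists2 p, Y p & {in s &, injective (point_eval p)}.
  by exists (point_eval p) => //; exact: Hom_F_point_eval.
apply: contrapT => noinj; apply: irrY.
have solY p : Y p <-> solutions E p by rewrite -YE.
pose q := [seq e <- [seq (u, v) | u <- s, v <- s] | e.1 != e.2].
pose e (j : 'I_(size q)) := tnth (in_tuple q) j.
exists (size q), (fun j =>
  [set p | Y p /\ point_eval p (e j).1 = point_eval p (e j).2])%classic.
split=> [j|].
  split.
    exists (E `|`
      [set (repr ((e j).1 : coord Y), repr ((e j).2 : coord Y))])%classic.
    apply/seteqP; split=> p /=.
      by move=> [/solY pE pj] _ [/pE//|->].
    by move=> pE; split=> [|]; [apply/solY => c Ec; apply: pE; left|
                                apply: (pE (_, _)); right].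
  have : e j \in q by exact: mem_tnth.
  rewrite mem_filter => /andP[/eqP ne _]; split=> [p []//|sub]; apply: ne.
  rewrite -[LHS](reprK (_ : coord Y)) -[RHS](reprK (_ : coord Y)).
  by apply/eq_coordP => p /sub[].
apply/seteqP; split=> p /= => [Yp|[j _ []]//].
apply: contrapT => np; apply: noinj; exists p => // u v us vs uv.
apply/eqP/negPn/negP => ne; apply: np.
have uvq : (u, v) \in q.
  by rewrite mem_filter ne; apply/allpairsP; exists (u, v).
have /tnthP[j ej] : (u, v) \in in_tuple q by [].
by exists j => //; rewrite /e -ej.
Qed.

End Coordinate.

Section DiscriminatedCoordinate.
Variables (I : choiceType) (d : Order.disp_t) (S : Fsemilattice I d).
Variables (m : nat) (s : 'I_m -> S).
Hypothesis s_gen : forall x, exists t, term_eval s t = x.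
Hypothesis discS : discriminated S.

Let relations : set (Fterm I m * Fterm I m) :=
  [set e | term_eval s e.1 = term_eval s e.2]%classic.

Let hom_point (h : S -> freesl I) : Fpoint I m := [ffun k => h (s k)].

Let hom_point_sol h : Hom_F S (self_Fsemilattice I) h ->
  solutions relations (hom_point h).
Proof. by move=> hH e /= se; rewrite !Feval_term_eval // se. Qed.

Let solutions_relationsP (t u : Fterm I m) :
  (\pi_(coord (solutions relations)) t = \pi_(coord (solutions relations)) u)%qT
  <-> term_eval s t = term_eval s u.
Proof.
rewrite eq_coordP; split=> [tu|tu p]; last by move=> /(_ (t, u) tu).
have [h hH hinj] := discS [:: term_eval s t; term_eval s u].
apply: hinj; rewrite ?inE ?eqxx ?orbT //.
by rewrite -!Feval_term_eval //; exact/tu/hom_point_sol.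
Qed.

(** Y is the set of solutions of the relations of S; its points are the
F-homomorphisms S -> F, read on the generators.  An equation which is not a
relation of S fails at some point of Y, so the coordinate semilattice of Y has
no more relations than S.  Finitely many such equations even fail at a common
point, so Y is not covered by finitely many proper algebraic subsets. *)
Lemma discriminated_coordinate :
  exists (n : nat) (Y : set (Fpoint I n)) (Y0 : (Y !=set0)%classic),
    [/\ algebraic Y, irreducible Y & F_isomorphic S (Gamma Y0)].
Proof.
have Y0 : (solutions relations !=set0)%classic.
  by have [h hH _] := discS [::]; exists (hom_point h); exact: hom_point_sol.
exists m, (solutions relations), Y0; split; first by exists relations.
  move=> [k [Z [Zalg YZ]]].
  (* Each Z j satisfies an equation which fails somewhere on Y, that is, one
     which is not a relation of S. *)
  have /choice[e eP] : forall j, exists e : Fterm I m * Fterm I m,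
      term_eval s e.1 <> term_eval s e.2 /\
      forall p, Z j p -> Feval p e.1 = Feval p e.2.
    move=> j; have [[E ZE] [_ nsub]] := Zalg j.
    apply: contrapT => noe; apply: nsub => p Yp; rewrite ZE => e Ee.
    apply: (Yp e); apply: contrapT => ne; apply: noe; exists e; split=> // q.
    by rewrite ZE => /(_ e Ee).
  have [h hH hinj] := discS ([seq term_eval s (e j).1 | j <- enum 'I_k] ++
                             [seq term_eval s (e j).2 | j <- enum 'I_k]).
  have : solutions relations (hom_point h) by exact: hom_point_sol.
  rewrite YZ => -[j _ Zj]; have [ne /(_ _ Zj)] := eP j.
  rewrite !Feval_term_eval // => /hinj he; apply: ne.
  by apply: he; rewrite mem_cat (map_f _ (mem_enum _ j)) ?orbT.
have /choice[t tK] := s_gen.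
exists (fun x => (\pi_(coord (solutions relations)) (t x))%qT : Gamma Y0).
  split=> [x y|f] /=.
    rewrite [RHS]coord_op_pi; apply/solutions_relationsP.
    by rewrite term_eval_hom !tK.
  by apply/solutions_relationsP; rewrite tK.
exists (fun u => term_eval s (repr (u : coord _))) => [x|u].
  by rewrite -[RHS]tK; apply/solutions_relationsP; rewrite reprK.
by rewrite -[RHS](reprK (_ : coord _)); apply/solutions_relationsP; rewrite tK.
Qed.

End DiscriminatedCoordinate.

(** * The free product of F and a free semilattice *)

Section FreeProduct.
Variables (I : choiceType) (n : nat).
Local Notation FT := (free_product (freesl I) (freesl 'I_n)).

Definition suppl (u : FT) : {fset I} :=
  match u with FPl f => val f | FPr _ => fset0 | FPlr f _ => val f end.

Definition suppr (u : FT) : {fset 'I_n} :=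
  match u with FPl _ => fset0 | FPr A => val A | FPlr _ A => val A end.

Lemma supplI u v : suppl (u `&` v) = (suppl u `|` suppl v)%fset.
Proof. by case: u v => [f|A|f A] [g|B|g B] //=; rewrite ?fset0U ?fsetU0. Qed.

Lemma supprI u v : suppr (u `&` v) = (suppr u `|` suppr v)%fset.
Proof. by case: u v => [f|A|f A] [g|B|g B] //=; rewrite ?fset0U ?fsetU0. Qed.

Lemma supp_inj u v : suppl u = suppl v -> suppr u = suppr v -> u = v.
Proof.
have val0 (K : choiceType) (A : freesl K) : val A <> fset0.
  by apply/eqP; exact: (valP A).
case: u v => [f|A|f A] [g|B|g B] //= fg AB;
  try by [case: (val0 _ _ fg)|case: (val0 _ _ AB)|
          case: (val0 _ _ (esym fg))|case: (val0 _ _ (esym AB))].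
- by rewrite (val_inj fg).
- by rewrite (val_inj AB).
- by rewrite (val_inj fg) (val_inj AB).
Qed.

Lemma supp_surj (X : {fset I}) (T : {fset 'I_n}) :
  (X != fset0) || (T != fset0) -> exists2 u, suppl u = X & suppr u = T.
Proof.
have [->|X0] := eqVneq X fset0; have [->|T0] := eqVneq T fset0 => //= _.
- by exists (FPr (FreeSL T0)).
- by exists (FPl (FreeSL X0)).
- by exists (FPlr (FreeSL X0) (FreeSL T0)).
Qed.

Lemma fresh_generators (X : {fset I}) : infinite_set [set: I]%classic ->
  exists2 j : 'I_n -> I, injective j & forall k, j k \notin X.
Proof.
move=> Iinf.
have [] := @infinite_set_fset _ ([set: I] `\` [set` X])%classic n.
  exact/infinite_setD/finite_fset.
move=> B BX nB; exists (fun k => tnth (in_tuple (enum_fset B)) (widen_ord nB k)).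
  move=> k l /(tuple_uniqP (in_tuple (enum_fset B))) kl.
  by apply/val_inj/(congr1 val (kl (fset_uniq B))).
move=> k; apply/negP; apply: (BX _ _).2.
exact: mem_tnth.
Qed.

(** Mapping the letters t_k to distinct generators of F that occur in no member
of the family loses no information on it: the two parts of a member can be read
off its image. *)
Lemma free_product_discriminated : infinite_set [set: I]%classic ->
  discriminated (fp_Fsemilattice I (freesl 'I_n)).
Proof.
move=> Iinf s; pose X := (\bigcup_(u <- s) suppl u)%fset.
have [j jinj jX] := fresh_generators X Iinf.
pose h : FT -> freesl I := fp_lift id (free_lift (fun k => freegen (j k))).
have hE u : val (h u) = (suppl u `|` j @` suppr u)%fset.
  by case: u => [f|A|f A] /=;
    rewrite ?val_freeslI ?val_free_lift_freegen ?imfset0 ?fset0U ?fsetU0.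
exists h; first by split=> //; apply: fp_lift_hom => //; exact: free_lift_hom.
have jsuppl u k : u \in s -> j k \notin suppl u.
  move=> us; apply: contra (jX k); apply/fsubsetP.
  exact: (bigfcup_sup suppl us).
have suppl_sub u v : u \in s -> h u = h v -> (suppl u `<=` suppl v)%fset.
  move=> us uv; apply/fsubsetP => i iu.
  have : i \in val (h v) by rewrite -uv hE inE iu.
  rewrite hE inE => /orP[//|/imfsetP[k _ ik]].
  by have := jsuppl u k us; rewrite -ik iu.
have suppr_sub u v : v \in s -> h u = h v -> (suppr u `<=` suppr v)%fset.
  move=> vs uv; apply/fsubsetP => k ku.
  have : j k \in val (h v) by rewrite -uv hE inE in_imfset ?orbT.
  by rewrite hE inE (negbTE (jsuppl v k vs)) /= => /imfsetP[l lv /jinj->].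
move=> u v us vs uv; have vu := esym uv.
by apply: supp_inj; apply/eqP; rewrite eqEfsubset ?suppl_sub ?suppr_sub.
Qed.

End FreeProduct.

(** * From the sentences phi and psi to an embedding *)

Section PhiPsi.
Variables (I : choiceType) (d : Order.disp_t) (S : Fsemilattice I d).
Local Notation a i := (Femb S (freegen i)).
Local Notation F := (self_Fsemilattice I).

Hypothesis I_infinite : infinite_set [set: I]%classic.
Hypothesis S_phi_psi : phi_psi S.

Lemma meet_le_gen i (x y : S) :
  (x `&` y <= a i) = (x <= a i) || (y <= a i).
Proof.
apply/idP/orP => [/(S_phi_psi i).2//|[] xi]; [exact: leIxl|exact: leIxr].
Qed.

(** When x and y lie below the same generators, phi_i allows cancelling a_i:
in its first two cases one of x and y lies below a_i, hence so does the other.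
By psi the hypothesis persists when x and y are multiplied by an element of F,
which makes the cancellation of a product possible factor by factor. *)
Lemma cancel_F (f : freesl I) (x y : S) : (forall i, (x <= a i) = (y <= a i)) ->
  x `&` Femb S f = y `&` Femb S f -> x = y.
Proof.
elim/freesl_ind: f x y => [k|f g IHf IHg] x y xy.
  move=> /(S_phi_psi k).1[E|E|//].
    by rewrite -E; apply/esym/meet_idPl; rewrite xy -E leIr.
  by rewrite E; apply/meet_idPl; rewrite -xy E leIr.
rewrite Femb_hom !meetA => E; apply: (IHf _ _ xy); apply: IHg E => i.
by rewrite !meet_le_gen xy.
Qed.

Variable h : S -> freesl I.
Hypothesis hH : Hom_F S F h.

(** This is {i | x <= a_i} by [in_content]; the generators dividing h x contain
it, which exhibits it as a finite set. *)
Definition content (x : S) : {fset I} := [fset i in val (h x) | x <= a i]%fset.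

Lemma in_content x i : (i \in content x) = (x <= a i).
Proof.
by rewrite !inE /=; apply: andb_idl => xi; exact: Hom_F_le_gen hH xi.
Qed.

(** An element x above some f in F and below no generator would absorb any
generator a_j not dividing f: xa_j and a_j have the same content and agree after
multiplication by f.  Then x >= a_j, so h x can only be a_j, which contradicts
h x >= f. *)
Lemma content_neq0 x f : Femb S f <= x -> content x != fset0.
Proof.
move=> fx; apply/eqP => x0.
have xn i : (x <= a i) = false by rewrite -in_content x0 inE.
have [j _ jf] : exists2 j, True & j \notin val f.
  have [j jinj jf] := @fresh_generators I 1 (val f) I_infinite.
  by exists (j ord0).
have ajx : a j <= x.
  apply/meet_idPr; apply: (@cancel_F f) => [i|].
    by rewrite meet_le_gen xn.
  by rewrite meetAC [RHS]meetC; congr (_ `&` _); apply/meet_idPr.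
have [hM hF] := hH; have hle y : Femb S y <= x -> (val (h x) `<=` val y)%fset.
  move=> /(hom_le hM); have /= -> := hF y; rewrite leEmeet => /eqP yx.
  by apply/fsetUidPl; rewrite -[LHS]/(val (y `&` h x)) yx.
have hxj : val (h x) = [fset j]%fset.
  apply/eqP; rewrite eqEfsubset (hle _ ajx) fsub1set.
  have pj := freesl_pickP (h x).
  by have := fsubsetP (hle _ ajx) _ pj; rewrite inE => /eqP <-.
have /fsubsetP/(_ j) := hle _ fx.
by rewrite hxj !inE (negbTE jf) eqxx => /(_ isT).
Qed.

(** The preorder of the quotient of S by the congruence xf = yf, f in F. *)
Definition le_mod (x y : S) : Prop := exists f, x `&` Femb S f <= y.

Lemma le_mod_trans x y z : le_mod x y -> le_mod y z -> le_mod x z.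
Proof.
move=> [f xy] [g yz]; exists (f `&` g); rewrite Femb_hom meetA.
exact: le_trans (leI2 xy (lexx _)) yz.
Qed.

Lemma le_modI x y z : le_mod z (x `&` y) <-> le_mod z x /\ le_mod z y.
Proof.
split=> [[f]|[[f zx] [g zy]]].
  by rewrite lexI => /andP[zx zy]; split; exists f.
exists (f `&` g); rewrite lexI Femb_hom.
by rewrite (le_trans _ zx) ?(le_trans _ zy) // leI2 // ?leIl ?leIr.
Qed.

Lemma le_mod_anti x y :
  content x = content y -> le_mod x y -> le_mod y x -> x = y.
Proof.
move=> xy [f fxy] [g gyx]; apply: (@cancel_F (f `&` g)) => [i|].
  by rewrite -!in_content xy.
apply: le_anti; rewrite !lexI !leIr !andbT Femb_hom.
by rewrite (le_trans _ fxy) ?(le_trans _ gyx) // leI2 // ?leIl ?leIr.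
Qed.

(** The quotient of S by xf = yf is finite: it consists of the classes of the
products of the finitely many generators of S over F, and of the unit, which is
the class of F. *)
Lemma le_mod_finite : finitely_generated S -> exists r : seq S,
  forall x, exists2 y, y \in r & le_mod x y /\ le_mod y x.
Proof.
move=> /finitely_generated_term_eval[m [s sgen]].
have [i _] := infinite_setN0 I_infinite; have [r rP] := freesl_finite 'I_m.
exists (a i :: [seq free_lift s A | A <- r]) => x.
have [[f|A|f A] <- /=] := sgen x.
- exists (a i); first by rewrite inE eqxx.
  by split; [exists (freegen i)|exists f]; exact: leIr.
- exists (free_lift s A); first by rewrite inE map_f ?orbT.
  by split; exists (freegen i); exact: leIl.
- exists (free_lift s A); first by rewrite inE map_f ?orbT.
  by split; exists f; [rewrite leIxl ?leIr|rewrite meetC].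
Qed.

Lemma phi_psi_embeddable : finitely_generated S ->
  exists n : nat, F_embeddable S (fp_Fsemilattice I (freesl 'I_n)).
Proof.
move=> /le_mod_finite[r rP]; exists (size r).
pose q k := tnth (in_tuple r) k.
(* The class of x goes to the classes that are not below it: this turns meets
   into unions and the unit, the greatest class, into the empty set. *)
pose T x : {fset 'I_(size r)} :=
  [fset k | k : 'I_(size r) & ~~ `[< le_mod (q k) x >]]%fset.
have inT x k : (k \in T x) = ~~ `[< le_mod (q k) x >] by rewrite !inE.
have T_le x y : T x = T y -> le_mod x y.
  move=> Txy; have [_ /(tnthP (in_tuple r))[k ->] [xk kx]] := rP x.
  apply: le_mod_trans xk _.
  by have := inT x k; rewrite Txy inT (asboolT kx) => /negbFE/asboolP.
have supp_neq0 x : (content x != fset0) || (T x != fset0).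
  apply/orP; have [Tx|] := eqVneq (T x) fset0; last by right.
  left; have [i _] := infinite_setN0 I_infinite.
  have [] : le_mod (a i) x.
    apply: T_le; rewrite Tx; apply/fsetP => k; rewrite inT inE.
    apply/negbTE; rewrite negbK; apply/asboolP.
    by exists (freegen i); exact: leIr.
  by move=> f; rewrite -Femb_hom; exact: content_neq0.
have /choice[e eP] : forall x, exists u, suppl u = content x /\ suppr u = T x.
  by move=> x; have [u ul ur] := supp_surj (supp_neq0 x); exists u.
exists e; last first.
  move=> x y exy; have [xl xr] := eP x; have [yl yr] := eP y.
  apply: le_mod_anti; first by rewrite -xl -yl exy.
    by apply: T_le; rewrite -xr -yr exy.
  by apply: T_le; rewrite -xr -yr exy.
split=> [x y|f] /=; apply: supp_inj.
- rewrite supplI !(eP _).1; apply/fsetP => i.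
  by rewrite inE !in_content meet_le_gen.
- rewrite supprI !(eP _).2; apply/fsetP => k; rewrite inE !inT -negb_and.
  by rewrite -asbool_and; congr (~~ _); apply: asbool_equiv_eq; exact: le_modI.
- by rewrite (eP _).1; apply/fsetP => i; rewrite in_content Femb_le le_freegen.
- rewrite (eP _).2; apply/fsetP => k; rewrite inT inE.
  by apply/negbTE; rewrite negbK; apply/asboolP; exists f; exact: leIr.
Qed.

End PhiPsi.

(** * The equivalence *)

Theorem theorem4p1 (I : choiceType) (I_infinite : infinite_set [set: I]%classic)
    (d : Order.disp_t) (S : Fsemilattice I d)
    (S_fg : finitely_generated S)
    (S_hom : (Hom_F S (self_Fsemilattice I) !=set0)%classic) :
  let a (i : I) : S := Femb S (freegen i) in
  [<->
    (exists (n : nat) (Y : set (Fpoint I n)) (Y0 : (Y !=set0)%classic),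
      [/\ algebraic Y, irreducible Y & F_isomorphic S (Gamma Y0)]);
    (exists n : nat, F_embeddable S (fp_Fsemilattice I (freesl 'I_n)));
    (forall i : I,
      (forall x y : S, (x `&` a i = y `&` a i <->
        [\/ x `&` a i = y, x = y `&` a i | x = y])%O) /\
      (forall x y : S, (x `&` y <= a i -> x <= a i \/ y <= a i)%O))].
Proof.
move=> a; have [h hH] := S_hom.
have emb_disc : (exists n, F_embeddable S (fp_Fsemilattice I (freesl 'I_n))) ->
    discriminated S.
  move=> [n emb]; apply: embeddable_discriminated emb _.
  exact: free_product_discriminated.
tfae.
- move=> [n [Y [Y0 [algY irrY [psi psiH /bij_inj psi_inj]]]]].
  have discS : discriminated S.
    apply: (@embeddable_discriminated _ _ _ S (Gamma Y0)); first by exists psi.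
    exact: Gamma_discriminated.
  exact: (phi_psi_embeddable I_infinite (discriminated_phi_psi discS) hH S_fg).
- by move=> /emb_disc/discriminated_phi_psi.
- move=> S_phi_psi.
  have [m [s sgen]] := finitely_generated_term_eval S_fg.
  apply: (discriminated_coordinate sgen); apply: emb_disc.
  exact: (phi_psi_embeddable I_infinite S_phi_psi hH S_fg).
Qed.
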